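(* Let $G$ be a Polish groupoid and $X$ a Polish $G$-space. The orbit equivalence relation $E_G^X$ is Borel if and only if there is a countable ordinal $\alpha\ge1$ such that every orbit is a $\mathbf{\Pi}^0_\alpha$ subset of $X$.
   Context: A groupoid is a small category in which every arrow is invertible; $G^0$ objects, $s,r$ source and range. A topological space is locally Polish if it has a countable basis of open sets Polish in the relative topology. A Polish groupoid is a groupoid with a locally Polish topology such that composition and inversion are continuous and open, $G^0$ is Polish, and $s^{-1}(x)$, $r^{-1}(x)$ are Polish for all $x\in G^0$. A Polish $G$-space is a Polish space $X$ with a continuous anchor $p:X\to G^0$ and a continuous map $(\gamma,x)\mapsto\gamma x$ on $\{(\gamma,x):s(\gamma)=p(x)\}$ with $\gamma(\rho x)=(\gamma\rho)x$, $p(\gamma x)=r(\gamma)$, $p(x)x=x$. The orbit of $x$ is $\{\gamma x: s(\gamma)=p(x)\}$ and $E_G^X$ is the equivalence relation whose classes are the orbits. *)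

(* Defs.v *)
From HB Require Import structures.
From mathcomp Require Import all_boot all_order all_algebra.
From mathcomp Require Import all_classical all_reals.
From mathcomp Require Import topology measurable_structure.

Set Implicit Arguments.
Unset Strict Implicit.
Unset Printing Implicit Defensive.

Import Order.TTheory GRing.Theory Num.Theory.
Local Open Scope classical_set_scope.
Local Open Scope ring_scope.

Record is_metric (R : realType) (T : Type) (d : T -> T -> R) : Prop := {
  is_metric_eq0 : forall x y, d x y = 0 <-> x = y ;
  is_metric_sym : forall x y, d x y = d y x ;
  is_metric_triangle : forall x y z, d x z <= d x y + d y z }.

Definition metric_compatible (R : realType) (T : topologicalType)
    (d : T -> T -> R) : Prop :=
  forall (x : T) (A : set T),
    nbhs x A <-> exists2 e : R, 0 < e & [set y | d x y < e] `<=` A.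

Definition metric_cauchy (R : realType) (T : Type) (d : T -> T -> R)
    (u : nat -> T) : Prop :=
  forall e : R, 0 < e ->
    exists N : nat, forall m n, (N <= m)%N -> (N <= n)%N -> d (u m) (u n) < e.

Definition metric_complete (R : realType) (T : topologicalType)
    (d : T -> T -> R) : Prop :=
  forall u : nat -> T, metric_cauchy d u -> exists l : T, u @ \oo --> l.

Definition separable_space (T : topologicalType) : Prop :=
  exists2 D : set T, countable D & dense D.

Definition polish (R : realType) (T : topologicalType) : Prop :=
  separable_space T /\
  exists d : T -> T -> R,
    [/\ is_metric d, metric_compatible d & metric_complete d].

(** The type [set_type A] carries the relative topology; [subspace A] would not
    do, since it keeps all the points outside of [A] as isolated points. *)
Definition polish_subset (R : realType) (T : topologicalType) (A : set T) :
  Prop := polish R (set_type A).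

(** No separation axiom is imposed globally: a locally Polish space need not be
    Hausdorff. *)
Definition locally_polish (R : realType) (T : topologicalType) : Prop :=
  exists B : set (set T),
    [/\ countable B, basis B & forall U, B U -> polish_subset R U].

(** A groupoid is given by its arrows, every object being identified with its
    identity arrow; [gsrc] and [grng] thus take values in arrows. The
    composition [gcomp g h] (first [h], then [g]) is a total function, whose
    value is meaningful only when [gsrc g = grng h]. *)
Record groupoid (G : Type) := Groupoid {
  gsrc : G -> G ;
  grng : G -> G ;
  gcomp : G -> G -> G ;
  ginv : G -> G ;
  gsrc_src : forall g, gsrc (gsrc g) = gsrc g ;
  grng_src : forall g, grng (gsrc g) = gsrc g ;
  gsrc_rng : forall g, gsrc (grng g) = grng g ;
  grng_rng : forall g, grng (grng g) = grng g ;
  gsrc_comp : forall g h, gsrc g = grng h -> gsrc (gcomp g h) = gsrc h ;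
  grng_comp : forall g h, gsrc g = grng h -> grng (gcomp g h) = grng g ;
  gcompA : forall g h k, gsrc g = grng h -> gsrc h = grng k ->
    gcomp g (gcomp h k) = gcomp (gcomp g h) k ;
  gcomp_src : forall g, gcomp g (gsrc g) = g ;
  gcomp_rng : forall g, gcomp (grng g) g = g ;
  gsrc_inv : forall g, gsrc (ginv g) = grng g ;
  grng_inv : forall g, grng (ginv g) = gsrc g ;
  gcomp_inv_l : forall g, gcomp (ginv g) g = gsrc g ;
  gcomp_inv_r : forall g, gcomp g (ginv g) = grng g }.

Definition gobjects (G : Type) (gr : groupoid G) : set G :=
  [set x | gsrc gr x = x].

Definition gcomposable (G : Type) (gr : groupoid G) : set (G * G) :=
  [set gh | gsrc gr gh.1 = grng gr gh.2].

Record polish_groupoid (R : realType) (G : topologicalType)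
    (gr : groupoid G) : Prop := {
  pg_locally_polish : locally_polish R G ;
  pg_comp_continuous :
    {within gcomposable gr, continuous (fun gh : G * G => gcomp gr gh.1 gh.2)} ;
  pg_comp_open : forall U : set (G * G), open U ->
    open [set gcomp gr gh.1 gh.2 | gh in U `&` gcomposable gr] ;
  pg_inv_continuous : continuous (ginv gr) ;
  pg_inv_open : forall U : set G, open U -> open (ginv gr @` U) ;
  pg_objects_polish : polish_subset R (gobjects gr) ;
  pg_src_fiber_polish : forall x, gobjects gr x ->
    polish_subset R [set g | gsrc gr g = x] ;
  pg_rng_fiber_polish : forall x, gobjects gr x ->
    polish_subset R [set g | grng gr g = x] }.

(** [gact g x] is meaningful only when [gsrc g = ganchor x]. *)
Record gspace (G : Type) (gr : groupoid G) (X : Type) := GSpace {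
  ganchor : X -> G ;
  gact : G -> X -> X ;
  ganchor_object : forall x, gobjects gr (ganchor x) ;
  ganchor_act : forall g x, gsrc gr g = ganchor x ->
    ganchor (gact g x) = grng gr g ;
  gact_comp : forall g h x, gsrc gr g = grng gr h -> gsrc gr h = ganchor x ->
    gact g (gact h x) = gact (gcomp gr g h) x ;
  gact_id : forall x, gact (ganchor x) x = x }.

Definition gactionable (G : Type) (gr : groupoid G) (X : Type)
    (a : gspace gr X) : set (G * X) :=
  [set gx | gsrc gr gx.1 = ganchor a gx.2].

Record polish_gspace (R : realType) (G : topologicalType) (gr : groupoid G)
    (X : topologicalType) (a : gspace gr X) : Prop := {
  ps_polish : polish R X ;
  ps_anchor_continuous : continuous (ganchor a) ;
  ps_act_continuous :
    {within gactionable a, continuous (fun gx : G * X => gact a gx.1 gx.2)} }.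

Definition gorbit (G : Type) (gr : groupoid G) (X : Type) (a : gspace gr X)
    (x : X) : set X :=
  [set gact a g x | g in [set g | gsrc gr g = ganchor a x]].

Definition gorbit_rel (G : Type) (gr : groupoid G) (X : Type)
    (a : gspace gr X) : set (X * X) :=
  [set xy | gorbit a xy.1 xy.2].

Definition borel (T : topologicalType) (A : set T) : Prop :=
  <<s @open T >> A.

(** A countable ordinal is represented by a countable well-ordered set of that
    order type; [well_order] makes [co_le] a total order. *)
Record countable_ordinal := CountableOrdinal {
  co_sort :> Type ;
  co_le : rel co_sort ;
  co_well_order : wochoice.well_order co_le ;
  co_countable : countable [set: co_sort] }.

Definition co_ge1 (alpha : countable_ordinal) : Prop :=
  exists x : alpha, True.

Definition co_eq1 (alpha : countable_ordinal) : Prop :=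
  exists x : alpha, forall y : alpha, y = x.

(** [beta] is isomorphic to a proper initial segment of [alpha]. *)
Definition co_lt (beta alpha : countable_ordinal) : Prop :=
  exists (a : alpha) (f : beta -> alpha),
    (forall x y, co_le (f x) (f y) = co_le x y) /\
    range f = [set z | ~~ co_le a z].

(** [Sigma0_bigcup] never applies when [alpha] is 0 or 1, so level 1 consists
    of the open sets and level 0 is empty. *)
Inductive Sigma0 (T : topologicalType) : countable_ordinal -> set T -> Prop :=
| Sigma0_open (alpha : countable_ordinal) (U : set T) :
    co_eq1 alpha -> open U -> Sigma0 alpha U
| Sigma0_bigcup (alpha : countable_ordinal) (beta : nat -> countable_ordinal)
    (F : nat -> set T) :
    (forall n, co_ge1 (beta n)) ->
    (forall n, co_lt (beta n) alpha) ->
    (forall n, Sigma0 (beta n) (~` F n)) ->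
    Sigma0 alpha (\bigcup_n F n).

Definition Pi0 (T : topologicalType) (alpha : countable_ordinal) (A : set T) :
  Prop := Sigma0 alpha (~` A).

(* Main.v *)
Require Import Defs.
From mathcomp Require Import all_boot all_order all_algebra.
From mathcomp Require Import all_classical all_reals.
From mathcomp Require Import topology measurable_structure.

(** If the orbit equivalence relation is Borel, it has a countable Borel rank, and
    so have its sections, the orbits.

    For the converse we follow Hjorth's analysis of actions. Points [x], [y] and
    open sets [U], [V] of arrows give local orbits [U x], [V y], compared by
    relations indexed by a countable ordinal: at every level the closure of [U x]
    is contained in that of [V y], and at level [c], for all [b < c] and basic
    [U' <= U] there is a basic [V' <= V] such that [V' y] is below [U' x] at
    level [b]. Since the source map is open, each of these relations is Borel in
    [(x, y)]. By induction on the rank, using the Baire category theorem and the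
    Baire property in the source fibers, if [U x] is below [V y] then a Pi^0 set
    of that level which contains [g y] for generic [g] in [V] contains [g x] for
    generic [g] in [U]. If all orbits are Pi^0_alpha, apply this to the orbit of
    [y] with [U = V = G]: the comparison at level [alpha], which clearly holds
    inside an orbit, forces [x] into the orbit of [y]. *)

Set Implicit Arguments.
Unset Strict Implicit.
Unset Printing Implicit Defensive.

Import Order.TTheory GRing.Theory Num.Theory.
Local Open Scope classical_set_scope.

(** * Countable ordinals and their suprema *)

Section CountableOrdinals.
Implicit Types alpha beta gamma : countable_ordinal.

Lemma co_min alpha (P : set alpha) :
  P !=set0 -> exists2 m, P m & forall z, P z -> co_le m z.
Proof.
move=> [x Px]; have [|m [[/asboolP Pm lem] _]] :=
  @co_well_order alpha [pred z | `[< P z >]].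
  by exists x; apply/asboolP.
by exists m => // z Pz; apply: lem; apply/asboolP.
Qed.

(** The order laws come from least elements alone: sets of one, two and three points give
    reflexivity, totality and transitivity; uniqueness of the least element gives antisymmetry. *)
Lemma co_lexx alpha : reflexive (@co_le alpha).
Proof.
by move=> x; have [|m -> lem] := @co_min _ [set x]; [exists x|exact: lem].
Qed.

Lemma co_le_total alpha : total (@co_le alpha).
Proof.
move=> x y; have [|m /= xym lem] := @co_min _ [set z | z = x \/ z = y].
  by exists x; left.
by case: xym lem => -> lem; apply/orP; [left|right]; apply: lem; [right|left].
Qed.

Lemma co_le_anti alpha : antisymmetric (@co_le alpha).
Proof.
move=> x y /andP[xy yx].
pose P := [pred z : alpha | `[< z = x \/ z = y >]].
have [|m [_ uniq]] := @co_well_order alpha P.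
  by exists x; apply/asboolP; left.
rewrite -(uniq x) ?(uniq y) //; split; try by apply/asboolP; auto.
- by move=> z /asboolP[] ->; rewrite ?co_lexx.
- by move=> z /asboolP[] ->; rewrite ?co_lexx.
Qed.

Lemma co_le_trans alpha : transitive (@co_le alpha).
Proof.
move=> y x z xy yz.
have [|m /= xyzm lem] := @co_min _ [set t | [\/ t = x, t = y | t = z]].
  by exists x; constructor 1.
have mx := lem x (Or31 _ _ erefl); have my := lem y (Or32 _ _ erefl).
have mz := lem z (Or33 _ _ erefl).
case: xyzm => e; subst m => //.
- by rewrite -(_ : y = x) //; apply: co_le_anti; rewrite xy mx.
- have yz' : y = z by apply: co_le_anti; rewrite my yz.
  by subst y.
Qed.

Lemma co_ltW alpha (x y : alpha) : ~~ co_le y x -> co_le x y.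
Proof. by have /orP[->|->] := co_le_total x y. Qed.

Lemma co_le_lt_trans alpha (y x z : alpha) :
  co_le x y -> ~~ co_le z y -> ~~ co_le z x.
Proof. by move=> xy; apply: contra => zx; exact: co_le_trans xy. Qed.

Lemma co_lt_ind alpha (P : alpha -> Prop) :
  (forall x, (forall y, ~~ co_le x y -> P y) -> P x) -> forall x, P x.
Proof.
move=> IH x; apply: contrapT => nPx.
have [|m nPm lem] := @co_min _ [set z | ~ P z]; first by exists x.
apply: nPm; apply: IH => y ym; apply: contrapT => /lem.
by rewrite (negbTE ym).
Qed.

Definition co_strict_mono alpha gamma (f : alpha -> gamma) :=
  forall x y, ~~ co_le y x -> ~~ co_le (f y) (f x).

Lemma co_strict_mono_le alpha gamma (f : alpha -> gamma) :
  co_strict_mono f -> forall x y, co_le (f x) (f y) = co_le x y.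
Proof.
move=> fm x y; apply/idP/idP => [fxy|]; last first.
  have [->|xy] := pselect (x = y); first by rewrite !co_lexx.
  move=> lexy; apply/co_ltW/fm; apply/negP => leyx.
  by apply: xy; apply: co_le_anti; rewrite lexy.
by apply: contraLR fxy => /fm.
Qed.

(** [seg_embeds x z]: the initial segment below [x] maps strictly increasingly
    into the one below [z]. The least such [z] is the image of [x] under the
    collapse of [alpha] onto an initial segment of [gamma]; this describes the
    collapse without transfinite recursion. *)
Definition seg_embeds alpha gamma (x : alpha) (z : gamma) :=
  exists h : alpha -> gamma, forall y, ~~ co_le x y ->
    ~~ co_le z (h y) /\ forall y', ~~ co_le y y' -> ~~ co_le (h y) (h y').

(** The image of [f] may have gaps, while [co_lt] asks for an initial segment. The collapse [g]
    closes the gaps. It stays below [f], hence below [c], so it misses a point, and the least point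
    missed bounds the image. *)
Lemma co_lt_strict_mono alpha gamma (f : alpha -> gamma) (c : gamma) :
  co_strict_mono f -> (forall x, ~~ co_le c (f x)) -> co_lt alpha gamma.
Proof.
move=> fm fc.
have /choice[g gP] : forall x : alpha, exists z : gamma,
    seg_embeds x z /\ forall z', seg_embeds x z' -> co_le z z'.
  move=> x; have [|m Pm lem] := @co_min _ [set z : gamma | seg_embeds x z].
    exists (f x); exists f => y yx; split; first exact: fm.
    by move=> y'; exact: fm.
  by exists m.
have gm : co_strict_mono g.
  move=> x y xy; have [[h hP] _] := gP y.
  have [hxy hx] := hP _ xy; apply: co_le_lt_trans hxy.
  apply: (gP x).2; exists h => t tx; split; first exact: hx.
  by apply: (hP _ _).2; apply: co_le_lt_trans xy; exact: co_ltW.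
have gc x : ~~ co_le c (g x).
  apply: co_le_lt_trans (fc x); apply: (gP x).2.
  by exists f => y yx; split; [exact: fm|move=> y'; exact: fm].
have gdown z x : co_le z (g x) -> range g z.
  move=> zgx.
  (* For the least such [y], the map [g] itself sends the segment below [y] below [z], so minimality
     of [g y] puts it below [z]. *)
  have [|y zgy leys] := @co_min _ [set y | co_le z (g y)]; first by exists x.
  exists y => //; apply: co_le_anti; rewrite zgy andbT; apply: (gP y).2.
  exists g => t ty; split; last by move=> y'; exact: gm.
  by apply: contra ty => /leys.
have [|a nga lea] := @co_min _ (~` range g).
  by exists c => -[x _ gxc]; have := gc x; rewrite gxc co_lexx.
exists a, g; split; first exact: co_strict_mono_le.
apply/seteqP; split => [_ [x _ <-] /=|z /= az].
  by apply/negP => /gdown.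
by apply: contrapT => /lea; rewrite (negbTE az).
Qed.

Lemma co_one : exists alpha, co_eq1 alpha /\ co_ge1 alpha.
Proof.
have wo : wochoice.well_order (fun _ _ : unit => true).
  by move=> A [[] At]; exists tt; split=> // -[].
exists (CountableOrdinal wo (countableP _)).
by split; exists tt => // -[].
Qed.

Section Sup.
Variable beta : nat -> countable_ordinal.

(** The ordinal sum of the [beta n] with a top element [None] added; the top
    is what makes the inequality in [co_sup] strict. *)
Let T := option {n : nat & beta n}.

Let le (u v : T) : bool :=
  match u, v with
  | _, None => true
  | None, Some _ => false
  | Some u, Some v => (tag u < tag v)%N ||
      ((tag u == tag v) && co_le (tagged u) (tagged_as u v))
  end.

Let le_tagged n (x y : beta n) :
  le (Some (Tagged beta x)) (Some (Tagged beta y)) = co_le x y.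
Proof. by rewrite /= ltnn eqxx tagged_asE. Qed.

Let le_min (P : set T) :
  P !=set0 -> exists z, P z /\ forall t, P t -> le z t.
Proof.
move=> P0.
have [[[n x] Pnx]|noS] := pselect (exists u, P (Some u)); last first.
  case: P0 => -[u Pu|PN]; first by exfalso; apply: noS; exists u.
  exists None; split=> // -[u Pu|//]; by exfalso; apply: noS; exists u.
have exn : exists n, `[< exists x : beta n, P (Some (Tagged beta x)) >].
  by exists n; apply/asboolP; exists x.
case: (ex_minnP exn) => m /asboolP[y Py] lem.
have [|z Pz lez] := @co_min _ [set z : beta m | P (Some (Tagged beta z))].
  by exists y.
exists (Some (Tagged beta z)); split=> // -[[k t] Pt|//].
have : (m <= k)%N by apply: lem; apply/asboolP; exists t.
rewrite leq_eqVlt => /orP[/eqP mk|mk]; last by rewrite /= mk.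
by subst k; rewrite le_tagged; exact: lez.
Qed.

Let le_wo : wochoice.well_order le.
Proof.
apply: wochoice.antisymmetric_well_order.
  move=> [[n x]|] [[m y]|] //= /andP[].
  case: ltngtP => //= nm.
  subst m; rewrite !tagged_asE /= => xy yx.
  by rewrite (@co_le_anti _ x y) ?xy.
move=> A [x Ax]; have [|z [Az lez]] := @le_min [set x | x \in A].
  by exists x.
by exists z; split=> // t At; exact: lez.
Qed.

Let T_countable : countable [set: T].
Proof.
pose F (i : option nat) : set T := if i is Some n
  then (fun x : beta n => Some (Tagged beta x)) @` setT else [set None].
have -> : [set: T] = \bigcup_i F i.
  apply/seteqP; split=> // -[[n x] _|_]; last by exists None.
  by exists (Some n) => //; exists x.
apply: bigcup_countable => // -[n|] _ //=.
exact: sub_countable (card_image_le _ _) (co_countable _).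
Qed.

Lemma co_sup : exists gamma, forall n, co_lt (beta n) gamma.
Proof.
pose gamma := CountableOrdinal le_wo T_countable; exists gamma => n.
apply: (@co_lt_strict_mono (beta n) gamma (fun x => Some (Tagged beta x)) None) => //.
by move=> x y xy /=; rewrite ltnn eqxx tagged_asE.
Qed.

End Sup.

End CountableOrdinals.

(** * Closure properties of Borel sets *)

Section BorelSets.
Variable T : topologicalType.
Implicit Types A B : set T.

Lemma borel_open A : open A -> borel A.
Proof. by move=> oA; exact: sub_sigma_algebra. Qed.

Lemma borelC A : borel A -> borel (~` A).
Proof.
have [_ DA _] := smallest_sigma_algebra [set: T] (@open T).
by rewrite -setTD; exact: DA.
Qed.

Lemma borel_bigcup I (D : set I) (F : I -> set T) : countable D ->
  (forall i, D i -> borel (F i)) -> borel (\bigcup_(i in D) F i).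
Proof.
move=> /countable_injP[f finj] FB.
have [B0 _ BU] := smallest_sigma_algebra [set: T] (@open T).
(* The injection [f] turns the union into a sequence; each inner index set is a singleton or
   empty. *)
suff -> : \bigcup_(i in D) F i =
    \bigcup_n \bigcup_(i in [set i | D i /\ f i = n]) F i.
  apply: BU => n; have [[i [Di fin]]|nD] := pselect (exists i, D i /\ f i = n).
    suff -> : [set i | D i /\ f i = n] = [set i] by rewrite bigcup_set1; exact: FB.
    apply/seteqP; split=> [j [Dj fjn]|_ ->//].
    by apply: finj; rewrite ?inE // fjn.
  rewrite (_ : [set i | _] = set0) ?bigcup_set0 //.
  by rewrite -subset0 => i Di; apply: nD; exists i.
apply/seteqP; split=> [x [i Di Fx]|x [n _ [i [Di _] Fx]]]; last by exists i.
by exists (f i) => //; exists i.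
Qed.

Lemma borel_bigcap I (D : set I) (F : I -> set T) : countable D ->
  (forall i, D i -> borel (F i)) -> borel (\bigcap_(i in D) F i).
Proof.
move=> cD FB; rewrite -[X in borel X]setCK setC_bigcap; apply: borelC.
by apply: borel_bigcup => // i Di; apply: borelC; exact: FB.
Qed.

Lemma borelU A B : borel A -> borel B -> borel (A `|` B).
Proof.
move=> bA bB; rewrite -bigcup2E; apply: borel_bigcup => // -[|[|n]] _ //=.
apply: borel_open; exact: open0.
Qed.

Lemma borelI A B : borel A -> borel B -> borel (A `&` B).
Proof.
move=> bA bB; rewrite -[X in borel X]setCK setCI.
by apply: borelC; apply: borelU; exact: borelC.
Qed.

End BorelSets.

(** * Countable Borel rank *)

Section BorelHierarchy.
Implicit Types T : topologicalType.

Lemma Sigma0_preimage T1 T2 (f : T1 -> T2) alpha (A : set T2) :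
  continuous f -> Sigma0 alpha A -> Sigma0 alpha (f @^-1` A).
Proof.
move=> /continuousP cf; elim=> {A} [{}alpha U al1 oU|{}alpha beta F b1 blt _ IH].
  by apply: Sigma0_open => //; exact: cf.
by rewrite preimage_bigcup; exact: Sigma0_bigcup b1 blt IH.
Qed.

Lemma Sigma0_setC T alpha beta (A : set T) : co_ge1 alpha -> co_lt alpha beta ->
  Sigma0 alpha A -> Sigma0 beta (~` A).
Proof.
move=> al1 lt sA; have <- : \bigcup_(_ in [set: nat]) ~` A = ~` A.
  by rewrite bigcup_const //; exists 0.
by apply: (@Sigma0_bigcup _ _ (fun=> alpha)) => // _; rewrite setCK.
Qed.

Lemma co_lt_ge1 (alpha beta : countable_ordinal) :
  co_lt alpha beta -> co_ge1 beta.
Proof. by case=> b _; exists b. Qed.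

Lemma borel_Sigma0 T (A : set T) :
  borel A -> exists alpha, co_ge1 alpha /\ Sigma0 alpha A.
Proof.
have [one [one1 one_ge]] := co_one.
move: A; apply: smallest_sub => [|U oU]; last first.
  by exists one; split=> //; exact: Sigma0_open.
split=> [|A [alpha [al1 sA]]|A /choice[alpha alP]].
- by exists one; split=> //; apply: Sigma0_open => //; exact: open0.
- have [beta /(_ 0) lt] := co_sup (fun=> alpha).
  exists beta; split; first exact: co_lt_ge1 lt.
  by rewrite setTD; exact: Sigma0_setC lt sA.
(* Two levels up: [beta n] serves the complement of [A n], which [Sigma0_bigcup] asks for, and
   [gamma] exceeds all [beta n]. *)
- have /choice[beta blt] n := co_sup (fun=> alpha n).
  have [gamma gP] := co_sup beta; exists gamma.
  split; first exact: co_lt_ge1 (gP 0).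
  apply: (@Sigma0_bigcup _ _ beta) => // n; first exact: co_lt_ge1 (blt n 0).
  exact: Sigma0_setC (alP n).1 (blt n 0) (alP n).2.
Qed.

End BorelHierarchy.

Lemma basis_nbhs (T : topologicalType) (B : set (set T)) (x : T) (A : set T) :
  basis B -> nbhs x A -> exists U, [/\ B U, U x & U `<=` A].
Proof. by move=> [_ /(_ x) Bx] /Bx[U [BU Ux] UA]; exists U. Qed.

Section Metric.
Local Open Scope ring_scope.
Variables (R : realType) (T : topologicalType) (d : T -> T -> R).
Hypotheses (dm : is_metric d) (dc : metric_compatible d).

Lemma metric_xx x : d x x = 0.
Proof. exact/(is_metric_eq0 dm). Qed.

Lemma open_metric_ball x r : open [set y | d x y < r].
Proof.
rewrite openE => y /= xy; apply/dc; exists (r - d x y); first by rewrite subr_gt0.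
by move=> z /=; rewrite ltrBrDl; apply: le_lt_trans; exact: is_metric_triangle.
Qed.

Lemma invS_lt (e : R) : 0 < e -> exists n, n.+1%:R^-1 < e.
Proof.
move=> e0; exists (Num.bound e^-1).
rewrite invf_plt ?posrE //.
have /lt_le_trans := archi_boundP (ltW (eqbRL (invr_gt0 _) e0)); apply.
by rewrite ler_nat.
Qed.

End Metric.

(** * Meager sets and the Baire property *)

Section Category.
Variable T : topologicalType.
Implicit Types (A M U : set T).

Definition meager M := exists2 D : set (set T), countable D &
  (forall N, D N -> open N /\ dense N) /\ M `<=` \bigcup_(N in D) ~` N.

Lemma meagerS A M : A `<=` M -> meager M -> meager A.
Proof.
by move=> AM [D cD [DP MD]]; exists D => //; split=> //; exact: subset_trans MD.
Qed.

Lemma meager0 : meager set0.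
Proof. by exists set0 => //; split=> [? []|? []]. Qed.

Lemma meager_bigcup (M : nat -> set T) :
  (forall n, meager (M n)) -> meager (\bigcup_n M n).
Proof.
move=> MP; have /choice[D DP] : forall n, exists D : set (set T), [/\ countable D,
    (forall N, D N -> open N /\ dense N) & M n `<=` \bigcup_(N in D) ~` N].
  by move=> n; have [D ? []] := MP n; exists D.
exists (\bigcup_n D n); first by apply: bigcup_countable => // n _; case: (DP n).
split=> [N [n _ DN]|x [n _ Mx]]; first by have [_ + _] := DP n; exact.
by have [_ _ /(_ x Mx)[N DN Nx]] := DP n; exists N => //; exists n.
Qed.

Lemma meagerU A M : meager A -> meager M -> meager (A `|` M).
Proof.
move=> mA mM; rewrite -bigcup2E; apply: meager_bigcup => -[|[|n]] //=.
exact: meager0.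
Qed.

Lemma meager_setC_dense U : open U -> dense U -> meager (~` U).
Proof.
move=> oU dU; exists [set U]; first exact: countable1.
by split=> [_ ->|x Ux] //; exists U.
Qed.

Definition baire_property A := exists O M,
  [/\ open O, meager M & forall z, ~ M z -> (A z <-> O z)].

Lemma baire_property_open A : open A -> baire_property A.
Proof. by move=> oA; exists A, set0; split=> //; exact: meager0. Qed.

(** The exterior of [O] replaces its complement; the two differ by the boundary of [O], which is
    closed with dense complement. *)
Lemma baire_property_setC A : baire_property A -> baire_property (~` A).
Proof.
move=> [O [M [oO mM AO]]].
exists (~` closure O), (M `|` ~` (O `|` ~` closure O)); split.
- exact/closed_openC/closed_closure.
- apply: meagerU => //; apply: meager_setC_dense.
    by apply: openU => //; exact/closed_openC/closed_closure.
  move=> U [x Ux] oU; have [[y [Oy Uy]]|OU] := pselect (O `&` U !=set0).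
    by exists y; split=> //; left.
  by exists x; split=> //; right => /(_ U (open_nbhs_nbhs (conj oU Ux))).
- move=> z /not_orP[/AO AOz /contrapT OcO].
  split=> [nAz|nOz Az]; first by case: OcO => // /AOz.
  by apply: nOz; apply: subset_closure; exact/AOz.
Qed.

Lemma baire_property_bigcup (F : nat -> set T) :
  (forall n, baire_property (F n)) -> baire_property (\bigcup_n F n).
Proof.
move=> /choice[O /choice[M OM]]; exists (\bigcup_n O n), (\bigcup_n M n); split.
- by apply: bigcup_open => n _; case: (OM n).
- by apply: meager_bigcup => n; case: (OM n).
- move=> z nMz; have FO n : F n z <-> O n z.
    by have [_ _] := OM n; apply => Mz; apply: nMz; exists n.
  by split=> -[n _ ?]; exists n => //; apply/FO.
Qed.

Lemma baire_property_Sigma0 alpha A : Sigma0 alpha A -> baire_property A.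
Proof.
elim=> {A} [{}alpha U _ oU|{}alpha beta F _ _ _ IH].
  exact: baire_property_open.
apply: baire_property_bigcup => n.
by rewrite -[F n]setCK; exact: baire_property_setC.
Qed.

(** Modulo a meager set [A] is an open [O], which must meet [U], as otherwise the part of [A] in [U]
    would be meager. *)
Lemma baire_property_nonmeager A U : baire_property A -> ~ meager (U `&` A) ->
  exists O, [/\ open O, O `&` U !=set0 & meager (O `&` ~` A)].
Proof.
move=> [O [M [oO mM AO]]] nUA; exists O; split=> //.
  apply: contrapT => OU; apply: nUA; apply: meagerS mM => z [Uz Az].
  by apply: contrapT => /AO[/(_ Az) Oz _]; apply: OU; exists z.
by apply: meagerS mM => z [Oz nAz]; apply: contrapT => /AO[_ /(_ Oz)].
Qed.

End Category.

(** * Second countability and the Baire category theorem *)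

Section PolishSpaces.
Local Open Scope ring_scope.
Variables (R : realType) (T : topologicalType).

Lemma polish_second_countable :
  polish R T -> @second_countable T.
Proof.
move=> [[D cD dD] [d [dm dc _]]].
pose ball (p : T * nat) := [set y | d p.1 y < p.2.+1%:R^-1].
exists (ball @` (D `*` setT)).
  by apply: sub_countable (card_image_le _ _) _; exact: countableX.
split=> [_ [p _ <-]|x A]; first exact: open_metric_ball.
move=> /dc[e e0 xA]; have [n n_lt] := @invS_lt R (e / 2) (divr_gt0 e0 (ltr0Sn _ _)).
have [|y [/= xy Dy]] := dD _ _ (open_metric_ball dm dc x n.+1%:R^-1).
  by exists x; rewrite /= metric_xx // invr_gt0.
exists (ball (y, n)); first by split; [exists (y, n)|rewrite /ball /= is_metric_sym].
move=> z /= yz; apply: xA => /=; apply: le_lt_trans (is_metric_triangle dm _ y _) _.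
by rewrite [e]splitr ltrD // (lt_trans _ n_lt).
Qed.

(** Nested balls: each closed ball lies in the preceding open ball and in the current [N n]; the
    centres converge to the required point. *)
Lemma baire_sequence (N : nat -> set T) (U : set T) : polish R T ->
  (forall n, open (N n) /\ dense (N n)) -> open U -> U !=set0 ->
  exists2 l, U l & forall n, N n l.
Proof.
move=> [_ [d [dm dc dcmpl]]] NP oU [x0 Ux0].
have ballT := is_metric_triangle dm; have ballS := is_metric_sym dm.
(* [f0] takes a stage, a centre and a radius to the next ball; for a nonpositive radius its value is
   a default. *)
have /choice[f0 f0P] : forall q : nat * (T * R), exists p' : T * R,
    0 < q.2.2 -> [/\ 0 < p'.2, p'.2 <= q.1.+1%:R^-1 &
      [set y | d p'.1 y <= p'.2] `<=` [set y | d q.2.1 y < q.2.2] `&` N q.1].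
  move=> [n [x r]] /=; have [r0|] := pselect (0 < r); last by exists (x, r).
  have [oN dN] := NP n.
  have [|y [/= xy Ny]] := dN _ _ (open_metric_ball dm dc x r).
    by exists x; rewrite /= metric_xx.
  have : nbhs y ([set y | d x y < r] `&` N n).
    apply: open_nbhs_nbhs; split=> //; apply: openI => //.
    exact: open_metric_ball.
  (* Halving [e] fits the closed ball into the open one of radius [e]; the other bound makes the
     centres Cauchy. *)
  move=> /dc[e e0 sub]; exists (y, Num.min (e / 2) n.+1%:R^-1) => _ /=; split.
  - by rewrite lt_min divr_gt0 //= invr_gt0.
  - by rewrite ge_min lexx orbT.
  - move=> z /=; rewrite le_min => /andP[yz _]; apply: sub => /=.
    by apply: le_lt_trans yz _; rewrite gtr_pMr // invf_lt1 ?ltr1n.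
have /dc[r0 r00 r0U] : nbhs x0 U by exact: open_nbhs_nbhs.
pose p := fix p n := if n is n'.+1 then f0 (n', p n') else (x0, r0).
have p_gt0 n : 0 < (p n).2 by elim: n => //= n IH; case: (f0P (n, p n)).
have pP n : (p n.+1).2 <= n.+1%:R^-1 /\ [set y | d (p n.+1).1 y <= (p n.+1).2]
    `<=` [set y | d (p n).1 y < (p n).2] `&` N n.
  by have [] := f0P (n, p n) (p_gt0 n).
have pm n k : [set y | d (p (k + n)%N).1 y < (p (k + n)%N).2] `<=`
    [set y | d (p n).1 y < (p n).2].
  elim: k => // k IH y /= yk; apply: IH.
  by have [_ /(_ y)[]] := pP (k + n)%N; first exact: ltW.
have pc n m : (n <= m)%N -> d (p n).1 (p m).1 < (p n).2.
  by move=> nm; apply: (pm n (m - n)%N); rewrite subnK //= metric_xx.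
have [|l lP] := dcmpl (fun n => (p n).1).
  move=> e e0; have [n n_lt] := @invS_lt R (e / 2) (divr_gt0 e0 (ltr0Sn _ _)).
  exists n.+1 => i j ni nj; have [ple _] := pP n.
  apply: le_lt_trans (ballT _ (p n.+1).1 _) _.
  rewrite [e]splitr ltrD // ?[d (p i).1 _]ballS;
    by apply: lt_trans (pc _ _ _) (le_lt_trans ple n_lt).
(* The limit is only known to lie in the closed balls, hence the closed balls on the left in
   [pP]. *)
have lb n : d (p n).1 l <= (p n).2.
  apply/ler_addgt0Pr => e e0.
  have : nbhs l [set y | d l y < e] by apply/dc; exists e.
  move=> /lP[k _ kP]; have /= lk := kP (maxn n k) (leq_maxr _ _).
  apply: le_trans (ballT _ (p (maxn n k)).1 _) _.
  by rewrite lerD // ltW // ?pc ?leq_maxl // ballS.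
exists l.
  by apply: r0U; have [_ /(_ l (lb 1%N))[]] := pP 0%N.
by move=> n; have [_ /(_ l (lb n.+1))[]] := pP n.
Qed.

Lemma polish_baire (M U : set T) :
  polish R T -> meager M -> open U -> U `<=` M -> ~ (U !=set0).
Proof.
move=> pT [D /countable_injP[f finj] [DP MD]] oU UM U0.
(* [N] enumerates [D] along [f]; a number that codes no member of [D] gives the whole space. *)
pose N n := [set x | forall V, D V -> f V = n -> V x].
have [n|l Ul Nl] := @baire_sequence N U pT _ oU U0; last first.
  by have [V DV] := MD _ (UM _ Ul); apply; exact: (Nl (f V)).
have [[V [DV fV]]|nV] := pselect (exists V, D V /\ f V = n).
  suff -> : N n = V by exact: DP.
  apply/seteqP; split=> [x|x Vx W DW fW]; first exact.
  by rewrite (finj W V) ?inE // fW.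
have -> : N n = setT.
  by apply/seteqP; split=> // x _ V DV fV; exfalso; apply: nV; exists V.
by split; [exact: openT|move=> O O0 _; rewrite setIT].
Qed.

End PolishSpaces.

(** [co_lt] with the bounding point exposed, so that a point [c] of one fixed ordinal can stand for
    the rank [beta]. *)
Definition co_segment (beta alpha : countable_ordinal) (c : alpha) :=
  exists f : beta -> alpha, (forall x y, co_le (f x) (f y) = co_le x y) /\
    range f = [set z | ~~ co_le c z].

(** A lower rank is represented by a lower point: [b] is the image of the bound of [alpha] in
    [beta]. *)
Lemma co_lt_segment (alpha beta gamma : countable_ordinal) (c : gamma) :
  co_lt alpha beta -> co_segment beta c ->
  exists2 b, ~~ co_le c b & co_segment alpha b.
Proof.
move=> [e [f [fm fe]]] [g [gm gc]].
have gP t : ~~ co_le c (g t) by have : range g (g t) by []; rewrite gc.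
exists (g e) => //; exists (g \o f); split=> [x y|]; first by rewrite /= gm fm.
apply/seteqP; split=> [_ [t _ <-] /=|z /= zge].
  by rewrite gm; have : range f (f t) by []; rewrite fe.
have [t _ gtz] : range g z.
  by rewrite gc /=; apply: co_le_lt_trans (gP e); exact: co_ltW.
have [s _ fst] : range f t by rewrite fe /= -gm gtz.
by exists s => //=; rewrite fst.
Qed.

Lemma within_prod_continuous (S T Y : topologicalType) (A : set (S * T))
    (f : S * T -> Y) (s : S) (t : T) (O : set Y) :
  {within A, continuous f} -> A (s, t) -> nbhs (f (s, t)) O ->
  exists U V, [/\ nbhs s U, nbhs t V &
    forall s' t', U s' -> V t' -> A (s', t') -> O (f (s', t'))].
Proof.
move=> /subspace_continuousP /(_ _) cf /cf /(_ O) + /[dup] Ofst => /(_ Ofst).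
by move=> [[U V] /= [nU nV] sub]; exists U, V; split=> // s' t' Us Vt; exact: sub.
Qed.

Lemma open_setX (S T : topologicalType) (U : set S) (V : set T) :
  open U -> open V -> open (U `*` V).
Proof.
move=> oU oV; apply: (@openI _ (fst @^-1` U) (snd @^-1` V)).
  by apply: open_comp => // x _; exact: cvg_fst.
by apply: open_comp => // x _; exact: cvg_snd.
Qed.

(** * Local orbits of a Polish groupoid action *)

Section OrbitAnalysis.
Variables (R : realType) (G : topologicalType) (gr : groupoid G).
Variables (X : topologicalType) (a : gspace gr X).
Hypotheses (hG : polish_groupoid R gr) (hX : polish_gspace R a).

Local Notation fiber x := [set g | gsrc gr g = ganchor a x].

Definition hits (U : set G) (O : set X) (x : X) :=
  exists g, [/\ U g, gsrc gr g = ganchor a x & O (gact a g x)].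

(** Openness of the source map, from that of composition and inversion: an object is a product of an
    inverse of an arrow of [U] with an arrow of [U] exactly when it is the source of an arrow of
    [U]. *)
Lemma open_hitsT U : open U -> open (hits U setT).
Proof.
move=> oU; pose W := [set gcomp gr gh.1 gh.2 |
  gh in (ginv gr @` U `*` U) `&` gcomposable gr].
suff -> : hits U setT = ganchor a @^-1` W.
  apply: open_comp => [x _|]; first exact: (ps_anchor_continuous hX).
  by apply: (pg_comp_open hG); apply: open_setX => //; exact: (pg_inv_open hG).
apply/seteqP; split=> [x [g [Ug sg _]]|x [[g' g] [[_ Ug] /= cg] /= gx]].
  exists (ginv gr g, g); last by rewrite /= gcomp_inv_l.
  by split; [split=> //; exists g|rewrite /gcomposable /= gsrc_inv].
exists g; split=> //; have := ganchor_object a x.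
by rewrite /gobjects /= -gx gsrc_comp.
Qed.

(** An arrow [g] from [x] need not start at the anchor of a nearby point, but by [open_hitsT] some
    arrow close to [g] does, and joint continuity keeps its value in [O]. *)
Lemma open_hits U O : open U -> open O -> open (hits U O).
Proof.
move=> oU oO; rewrite openE => x [g [Ug sg Ogx]].
have [W [N [nW nN WN]]] := within_prod_continuous (ps_act_continuous hX)
  (sg : gactionable a (g, x)) (open_nbhs_nbhs (conj oO Ogx)).
have : nbhs x (N `&` hits (W^° `&` U) setT).
  apply: filterI => //; apply: open_nbhs_nbhs; split.
    by apply/open_hitsT/openI => //; exact: open_interior.
  by exists g.
apply: filterS => y [Ny [h [[Wh Uh] sh _]]]; exists h; split=> //.
by apply: WN => //; exact: interior_subset.
Qed.

Lemma translation_continuous (h g : G) U : open U -> U g ->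
  gsrc gr g = grng gr h ->
  exists2 W, nbhs (gcomp gr g h) W &
    forall k, W k -> gsrc gr k = gsrc gr h -> U (gcomp gr k (ginv gr h)).
Proof.
move=> oU Ug gh.
have ghh : gcomp gr (gcomp gr g h) (ginv gr h) = g.
  by rewrite -gcompA ?grng_inv // gcomp_inv_r -gh gcomp_src.
have [||W [N [nW nN WN]]] := @within_prod_continuous _ _ _ _ _
  (gcomp gr g h) (ginv gr h) U (pg_comp_continuous hG).
- by rewrite /gcomposable /= gsrc_comp // grng_inv.
- by rewrite /= ghh; exact: open_nbhs_nbhs.
exists W => // k Wk sk; apply: (WN k (ginv gr h)) => //.
  exact: nbhs_singleton nN.
by rewrite /gcomposable /= grng_inv.
Qed.

(** * Hjorth's comparison and category in the source fibers *)

Section HjorthOrder.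
Variables (alpha : countable_ordinal) (B : set (set G)) (BX : set (set X)).
Hypotheses (cB : countable B) (bB : basis B).
Hypotheses (cBX : countable BX) (bBX : basis BX).

(** Hjorth's comparison of the local orbits [U x] and [V y]; at level [c] it
    transfers the Vaught transforms of the Pi^0 sets of that level from [V y] to
    [U x]. *)
Inductive hjorth_le (c : alpha) (U V : set G) (x y : X) : Prop :=
  HjorthLe of (forall O, BX O -> hits U O x -> hits V O y) &
    (forall b, ~~ co_le c b -> forall U', B U' -> U' `<=` U -> hits U' setT x ->
      exists V', [/\ B V', V' `<=` V, hits V' setT y & hjorth_le b V' U' y x]).

(** Right translation by [h] takes [U] over [x] into [V]. For [g] in [U'], a small basic [V'] around
    [g h] is taken back into [U'] by the inverse of [h], so the same situation recurs at a lower
    level with the points exchanged. *)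
Lemma orbit_hjorth_le c U V x y h : open V ->
  gsrc gr h = ganchor a y -> x = gact a h y ->
  (forall g, U g -> gsrc gr g = ganchor a x -> V (gcomp gr g h)) ->
  hjorth_le c U V x y.
Proof.
elim/co_lt_ind: c U V x y h => c IH U V x y h oV hy xE UV.
have px : ganchor a x = grng gr h by rewrite xE ganchor_act.
split=> [O _ [g [Ug gx Ogx]]|b bc U' BU' U'U [g [U'g gx _]]].
  exists (gcomp gr g h); split; first exact: UV.
    by rewrite gsrc_comp // gx.
  by rewrite -gact_comp ?gx // -xE.
have oU' : open U' by exact: bB.1.
have [|W nW Wk] := translation_continuous oU' U'g (h := h).
  by rewrite gx.
have : nbhs (gcomp gr g h) (W `&` V).
  by apply: filterI => //; apply: open_nbhs_nbhs; split=> //; apply: UV => //; exact: U'U.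
move=> /(basis_nbhs bB)[V' [BV' V'gh V'WV]]; exists V'; split=> //.
- by move=> k /V'WV[].
- by exists (gcomp gr g h); split=> //; rewrite gsrc_comp // gx.
- apply: (IH b bc _ _ _ _ (ginv gr h)) => //.
  + by rewrite gsrc_inv.
  + rewrite xE gact_comp ?gsrc_inv // gcomp_inv_l hy.
    by rewrite gact_id.
  + by move=> k /V'WV[Wk' _] ky; apply: Wk => //; rewrite ky.
Qed.

(** All quantifiers range over countable families. The maps [u] and [v] are arbitrary because the
    recursion exchanges the two points. *)
Lemma hjorth_le_borel c U V (u v : X * X -> X) : open U -> open V ->
  continuous u -> continuous v ->
  borel [set xy | hjorth_le c U V (u xy) (v xy)].
Proof.
elim/co_lt_ind: c U V u v => c IH U V u v oU oV cu cv.
have hitsB w W O : continuous w -> open W -> open O ->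
    borel (w @^-1` (hits W O) : set (X * X)).
  move=> cw oW oO; apply: borel_open; apply: open_comp => [x _|]; first exact: cw.
  exact: open_hits.
have oB W : B W -> open W by exact: bB.1.
have -> : [set xy | hjorth_le c U V (u xy) (v xy)] =
  (\bigcap_(O in BX) (~` (u @^-1` hits U O) `|` v @^-1` hits V O)) `&`
  \bigcap_(b in [set b | ~~ co_le c b])
    \bigcap_(U' in [set U' | B U' /\ U' `<=` U])
      (~` (u @^-1` hits U' setT) `|`
       \bigcup_(V' in [set V' | B V' /\ V' `<=` V])
         (v @^-1` hits V' setT `&`
          [set xy | hjorth_le b V' U' (v xy) (u xy)])).
  apply/seteqP; split=> [xy [h1 h2]|xy [h1 h2]].
    have orI (P Q : Prop) : (P -> Q) -> ~ P \/ Q by move=> PQ; rewrite -implyE.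
    split=> [O BO|b bc U' [BU' U'U]]; apply: orI; first exact: h1.
    move=> hU'; have [V' [BV' V'V hV' le']] := h2 b bc U' BU' U'U hU'.
    by exists V'.
  split=> [O BO|b bc U' BU' U'U].
    by have [] := h1 O BO.
  by have [//|[V' [BV' V'V] [hV' le']]] := h2 b bc U' (conj BU' U'U); exists V'.
apply: borelI.
  apply: borel_bigcap => // O BO; have oO : open O by exact: bBX.1.
  by apply: borelU; [apply: borelC|]; exact: hitsB.
apply: borel_bigcap => [|b bc].
  exact: sub_countable (subset_card_le (@subsetT _ _)) (co_countable alpha).
have cBS W : countable [set W' | B W' /\ W' `<=` W].
  by apply: sub_countable cB; apply: subset_card_le => W' [].
apply: borel_bigcap => // U' [/oB oU' _]; apply: borelU.
  by apply: borelC; exact: hitsB openT.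
apply: borel_bigcup => // V' [/oB oV' _]; apply: borelI.
  exact: hitsB openT.
exact: IH.
Qed.

(** A Vaught transform of the complement of [C]: generic arrows of [U] in the source fiber move [x]
    outside [C]. *)
Definition meager_hits (U : set G) (C : set X) (x : X) :=
  meager [set g : set_type (fiber x) |
    U (set_val g) /\ C (gact a (set_val g) x)].

Lemma fiber_polish x : polish R (set_type (fiber x)).
Proof. exact: (pg_src_fiber_polish hG (ganchor_object a x)). Qed.

Lemma orbit_map_continuous x :
  continuous (fun g : set_type (fiber x) => gact a (set_val g) x).
Proof.
move=> g O nO.
have [|W [N [nW nN WN]]] := @within_prod_continuous _ _ _ _ _
  (set_val g) x O (ps_act_continuous hX) _ nO.
  exact: (set_valP g).
have : nbhs g (set_val @^-1` W) by exact: initial_continuous nW.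
apply: filterS => k Wk; apply: (WN _ x) => //; first exact: nbhs_singleton nN.
exact: (set_valP k).
Qed.

Lemma open_fiber x (W : set G) : open W ->
  open (set_val @^-1` W : set (set_type (fiber x))).
Proof. by move=> oW; apply: open_comp => // g _; exact: initial_continuous. Qed.

Lemma nonmeager_hits x U M : open U -> hits U setT x ->
  meager M -> (forall g : set_type (fiber x), U (set_val g) -> M g) -> False.
Proof.
move=> oU [g [Ug gx _]] mM UM.
apply: (polish_baire (fiber_polish x) mM (open_fiber x oU) UM).
by exists (SigSub (mem_set gx : g \in fiber x)).
Qed.

(** An open set meager in a Polish fiber is empty, so the open case is the comparison of closures.
    For a union, a nonmeager [F n] would be comeager in a basic [U']; induction for its complement,
    with the points exchanged, makes both [F n] and its complement meager in the matching [V']. *)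
Lemma meager_hits_le beta C : Sigma0 beta C ->
  forall (c : alpha) U V x y, open U -> open V -> co_segment beta c ->
  hjorth_le c U V x y -> meager_hits V C y -> meager_hits U C x.
Proof.
elim=> {beta C} [beta C _ oC|beta beta' F _ blt sF IH] c U V x y oU oV bc.
  move=> [UV _] mV; apply: meagerS (@meager0 _) => g [Ug Cgx].
  have [O [BO Ogx OC]] := basis_nbhs bBX (open_nbhs_nbhs (conj oC Cgx)).
  have [|k [Vk ky Oky]] := UV O BO.
    by exists (set_val g); split=> //; exact: (set_valP g).
  have oVC : open [set g : set_type (fiber y) |
      V (set_val g) /\ C (gact a (set_val g) y)].
    apply: openI; first exact: open_fiber.
    by apply: open_comp => // h _; exact: orbit_map_continuous.
  apply: (polish_baire (fiber_polish y) mV oVC) => //.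
  exists (SigSub (mem_set ky : k \in fiber y)); split=> //.
  exact: OC.
move=> [_ UV] mV.
suff mU n : meager_hits U (F n) x.
  apply: meagerS (meager_bigcup mU) => g [Ug [n _ Fn]].
  by exists n.
apply: contrapT => nmU.
have BPn : baire_property
    ((fun g : set_type (fiber x) => gact a (set_val g) x) @^-1` F n).
  rewrite -[X in baire_property X]setCK; apply: baire_property_setC.
  apply: baire_property_Sigma0 (Sigma0_preimage _ (sF n)).
  exact: orbit_map_continuous.
have [_ [[W oW <-] [g [/= Wg Ug]] mW]] := baire_property_nonmeager BPn nmU.
have [U' [BU' U'g U'WU]] :=
  basis_nbhs bB (open_nbhs_nbhs (conj (openI oW oU) (conj Wg Ug))).
(* [b] is the level of rank [beta' n], where the comparison is applied to [U']. *)
have [b bltc segb] := co_lt_segment (blt n) bc.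
have [|||V' [BV' V'V hV' le']] := UV b bltc U' => //.
- by move=> k /U'WU[].
- by exists (set_val g); split=> //; exact: (set_valP g).
have mV' : meager_hits V' (~` F n) y.
  apply: IH le' _ => //; [exact: bB.1|exact: bB.1|].
  by apply: meagerS mW => k [/U'WU[Wk _] nFk].
apply: (nonmeager_hits (bB.1 _ BV') hV' (meagerU mV mV')) => k V'k.
have [Fk|nFk] := pselect (F n (gact a (set_val k) y)); last by right.
by left; split; [exact: V'V|exists n].
Qed.

End HjorthOrder.
End OrbitAnalysis.

(** * Borel orbit equivalence relations *)

Theorem theorem2p21 (R : realType) (G : topologicalType) (gr : groupoid G)
    (X : topologicalType) (a : gspace gr X)
    (hG : polish_groupoid R gr) (hX : polish_gspace R a) :
  borel (gorbit_rel a) <->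
  exists alpha : countable_ordinal,
    co_ge1 alpha /\ forall x : X, Pi0 alpha (gorbit a x).
Proof.
split=> [/borel_Sigma0[alpha [al1 sE]]|[alpha [al1 piE]]].
  (* One level up, the Sigma^0 sections become Pi^0. *)
  have [beta /(_ 0) lt] := co_sup (fun=> alpha).
  exists beta; split=> [|x]; first exact: co_lt_ge1 lt.
  apply: Sigma0_setC al1 lt _.
  apply: (@Sigma0_preimage _ _ (fun y => (x, y)) _ _ _ sE) => y.
  by apply: cvg_pair; [exact: cvg_cst|exact: cvg_id].
have [B [cB bB _]] := pg_locally_polish hG.
have [BX cBX bBX] := polish_second_countable (ps_polish hX).
(* A larger ordinal [beta] supplies a point [c] below which the order type is [alpha]. *)
have [beta /(_ 0)[c cseg]] := co_sup (fun=> alpha).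
(* The second point comes first: what generic translates of [x] avoid, those of [y] then avoid
   too. *)
suff -> : gorbit_rel a =
    [set xy | hjorth_le a B BX c setT setT xy.2 xy.1].
  apply: (hjorth_le_borel hG hX) => //; try exact: openT.
    by move=> xy; exact: cvg_snd.
  by move=> xy; exact: cvg_fst.
apply/seteqP; split=> [[x y] /= [g gx gxy]|[x y] /= le].
  exact: (orbit_hjorth_le hG BX bB c openT gx (esym gxy)).
have mx : meager_hits a setT (~` gorbit a x) x.
  apply: meagerS (@meager0 _) => g [_ ng]; apply: ng.
  by exists (set_val g) => //; exact: (set_valP g).
have my := meager_hits_le hG hX bB bBX (piE x) openT openT cseg le mx.
have hy : hits a setT setT y.
  by exists (ganchor a y); split=> //; exact: ganchor_object.
(* With [y] outside the orbit of [x], all its translates are outside, and the whole fiber over [y]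
   would be meager. *)
apply: contrapT => nxy; apply: (nonmeager_hits hG openT hy my) => g _.
split=> // -[h /= hx hxy]; apply: nxy.
have gy : gsrc gr (set_val g) = ganchor a y by exact: (set_valP g).
have rg : grng gr (set_val g) = grng gr h.
  by rewrite -(ganchor_act gy) -hxy ganchor_act.
exists (gcomp gr (ginv gr (set_val g)) h); rewrite /=.
  by rewrite gsrc_comp ?gsrc_inv.
rewrite -gact_comp ?gsrc_inv // hxy gact_comp ?gsrc_inv //.
by rewrite gcomp_inv_l gy gact_id.
Qed.
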